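(* Let $n\ge 1$ and let $G$ be a loopless directed graph (multiple edges allowed) on the vertex set $[n+1]$ with a unique sink, each edge being directed from its smaller to its larger endpoint. Let $\mathbf a=(a_1,\dots,a_{n+1})\in\mathbb Z_{\ge 0}^{n}\times\mathbb Z_{\le 0}$. Then the polynomials $N(\sigma^{\varphi}_{G(\mathbf a)})$ and $N(\sigma^{\psi}_{G(\mathbf a)})$ are Lorentzian.
   Context: Graphs are finite; since edges go from smaller to larger vertices, the unique sink is $n+1$, i.e. every $i\in[n]$ has at least one outgoing edge. For $i<j$ let $M(i,j)$ be the number of edges from $i$ to $j$, and denote these edges $(i,j;k)$, $k\in[M(i,j)]$. Flow polytope: $\mathcal F_G(\mathbf a)=\{f\in\mathbb R_{\ge0}^{E(G)}: M_Gf=\mathbf a\}$, where $M_G$ is the matrix whose column indexed by an edge $(i,j;k)$, $i<j$, is $e_i-e_j\in\mathbb R^{n+1}$. $S_G$ is the set of edges of $G$ incident to $n+1$; $T_G=\{i\in[n]: M(i,n+1)\ge1\}$; $I_i\subseteq S_G$ is the set of edges from $i$ to $n+1$. $\varphi:\mathcal F_G(\mathbf a)\to\mathbb R^{S_G}$ is the projection to the coordinates indexed by $S_G$. $\psi:\mathcal F_G(\mathbf a)\to\mathbb R^{T_G}$ is $\psi(f)=(\sum_{e\in I_i}f_e)_{i\in T_G}$. Define $$\sigma^{\varphi}_{G(\mathbf a)}(\mathbf x)=\sum_{\mathbf p\in\mathcal F_G(\mathbf a)\cap\mathbb Z^{E(G)}}\mathbf x^{\varphi(\mathbf p)},\qquad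 \sigma^{\psi}_{G(\mathbf a)}(\mathbf x)=\sum_{\mathbf p\in\mathcal F_G(\mathbf a)\cap\mathbb Z^{E(G)}}\mathbf x^{\psi(\mathbf p)},$$ polynomials in variables indexed by $S_G$ and $T_G$ respectively (empty sums being the zero polynomial). Normalization: $N$ is the linear operator on polynomials with $N(\mathbf x^\alpha)=\mathbf x^\alpha/\alpha!$, $\alpha!=\prod_i\alpha_i!$. M-convexity: $J\subseteq\mathbb N^m$ is M-convex if for any index $i$ and any $\alpha,\beta\in J$ with $\alpha_i>\beta_i$ there is an index $j$ with $\alpha_j<\beta_j$, $\alpha-e_i+e_j\in J$ and $\beta-e_j+e_i\in J$ (the empty set is M-convex). Lorentzian polynomials: let $\mathrm H^d_m$ be the space of real homogeneous degree-$d$ polynomials in $m$ variables (including $0$), and $\mathrm M^d_m\subseteq\mathrm H^d_m$ the set of those with nonnegative coefficients and M-convex support. $\mathrm L^0_m$ is the set of nonnegative constants; $\mathrm L^1_m$ is the set of linear forms with nonnegative coefficients; $\mathrm L^2_m$ is the set of $f\in\mathrm M^2_m$ whose Hessian $(\partial_i\partial_jf)_{i,j}$ has at most one positive eigenvalue (counted with multiplicity); for $d>2$, $\mathrm L^d_m=\{f\in\mathrm M^d_m:\partial_if\in\mathrm L^{d-1}_m\text{ for all }i\}$. A polynomial is Lorentzian if it lies in some $\mathrm L^d_m$. The same definitions are used for variables indexed by any finite set. *)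

(* Defs.v *)
From HB Require Import structures.
From mathcomp Require Import all_boot all_order all_algebra.
From mathcomp Require Import boolp classical_sets functions cardinality.
From mathcomp Require Import fsbigop reals.
From mathcomp Require Import polyrcf mpoly.

Set Implicit Arguments.
Unset Strict Implicit.
Unset Printing Implicit Defensive.

Import Order.TTheory GRing.Theory Num.Theory.

Local Open Scope ring_scope.

(* Polynomials in variables indexed by a finite set A are elements of
   {mpoly R[#|A|]}: the variable of index k : 'I_#|A| is the one attached to
   the element enum_val k of A. *)

Section Lorentzian.

Variables (R : realType) (m : nat).
Implicit Types (p : {mpoly R[m]}) (d : nat).

Definition normalize p : {mpoly R[m]} :=
  \sum_(u <- msupp p) (p@_u / (\prod_(i < m) (u i)`!)%:R) *: 'X_[u].

Definition Mconvex (J : {pred 'X_{1..m}}) : Prop :=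
  forall (i : 'I_m) (u v : 'X_{1..m}), u \in J -> v \in J -> (v i < u i)%N ->
  exists j : 'I_m, [/\ (u j < v j)%N,
    (u - U_(i) + U_(j))%MM \in J & (v - U_(j) + U_(i))%MM \in J].

Definition nonneg_coeffs p : Prop := forall u, 0 <= p@_u.

Definition Mclass d p : Prop :=
  [/\ p \is d.-homog, nonneg_coeffs p & Mconvex [pred u in msupp p]].

(* The second partial derivatives of a quadratic form are constant
   polynomials; the matrix collects their values. *)
Definition hessian p : 'M[R]_m := \matrix_(i, j) (p^`M(i)^`M(j))@_0%MM.

Definition count_pos_eigenvalues (A : 'M[R]_m) : nat :=
  \sum_(x <- rootsR (char_poly A) | 0 < x) mup x (char_poly A).

Fixpoint lorentzian_deg d p : Prop :=
  match d with
  | 0 => exists2 c : R, 0 <= c & p = c%:MP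
  | 1 => p \is 1.-homog /\ nonneg_coeffs p
  | 2 => Mclass 2 p /\ (count_pos_eigenvalues (hessian p) <= 1)%N
  | d'.+1 => Mclass d p /\ forall i : 'I_m, lorentzian_deg d' p^`M(i)
  end.

Definition lorentzian p : Prop := exists d, lorentzian_deg d p.

End Lorentzian.

(* Directed multigraphs on n.+1 vertices; the vertex k of [n+1] is the
   ordinal of value k - 1, so that the vertex n+1 is ord_max. *)
Record multigraph (n : nat) := Multigraph {
  edge : finType;
  src : edge -> 'I_n.+1;
  tgt : edge -> 'I_n.+1
}.

Section Graph.

Variables (n : nat) (G : multigraph n).
Implicit Types (i j : 'I_n.+1) (e : edge G).

Definition loopless : Prop := forall e, src e != tgt e.

Definition increasing : Prop := forall e, (src e < tgt e)%N.

Definition is_sink i : Prop := forall e, src e != i.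

Definition multiplicity i j : nat :=
  #|[set e : edge G | src e == i & tgt e == j]|.

Definition sink_edges : {set edge G} :=
  [set e | (src e == ord_max) || (tgt e == ord_max)].

Definition sink_nbrs : {set 'I_n.+1} :=
  [set i | (i != ord_max) && (1 <= multiplicity i ord_max)%N].

Definition edges_to_sink i : {set edge G} :=
  [set e in sink_edges | src e == i & tgt e == ord_max].

Definition phi (V : nmodType) (f : {ffun edge G -> V}) :
    {ffun 'I_#|sink_edges| -> V} :=
  [ffun k => f (enum_val k)].

Definition psi (V : nmodType) (f : {ffun edge G -> V}) :
    {ffun 'I_#|sink_nbrs| -> V} :=
  [ffun k => \sum_(e in edges_to_sink (enum_val k)) f e].

Variable R : realType.

Definition incidence_mx : 'M[R]_(n.+1, #|edge G|) :=
  \matrix_(v, k) ((src (enum_val k : edge G) == v)%:R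
                  - (tgt (enum_val k : edge G) == v)%:R).

Definition flow_polytope (a : 'cV[R]_n.+1) : set {ffun edge G -> R} :=
  [set f : {ffun edge G -> R} |
    (forall e, 0 <= f e) /\ incidence_mx *m \col_k f (enum_val k) = a]%classic.

Definition lattice_points (a : 'cV[int]_n.+1) : set {ffun edge G -> int} :=
  [set p : {ffun edge G -> int} |
    flow_polytope (map_mx intr a) [ffun e => (p e)%:~R]]%classic.

(* The exponents are nonnegative on lattice points of flow polytopes, where
   the absolute value is just the cast from int to nat. *)
Definition xpow m (u : {ffun 'I_m -> int}) : {mpoly R[m]} :=
  'X_[[multinom `|u k|%N | k < m]].

(* Sums over the sets [lattice_points a], which are finite for increasing
   graphs by [finite_lattice_points] below. *)
Definition sigma_phi (a : 'cV[int]_n.+1) : {mpoly R[#|sink_edges|]} :=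
  \sum_(p \in lattice_points a) xpow (phi p).

Definition sigma_psi (a : 'cV[int]_n.+1) : {mpoly R[#|sink_nbrs|]} :=
  \sum_(p \in lattice_points a) xpow (psi p).

(* Pairing M_G f = a with the weights i |-> n - i bounds the sum of all f_e. *)
Lemma finite_lattice_points (a : 'cV[int]_n.+1) :
  increasing -> finite_set (lattice_points a).
Proof.
move=> incG.
pose B : int := \sum_(v < n.+1) (n - v)%:Z * a v 0.
pose toZ (g : {ffun edge G -> 'I_`|B|.+1}) : {ffun edge G -> int} :=
  [ffun e => (g e)%:Z].
apply: (@sub_finite_set _ _ (toZ @` setT)%classic); last first.
  exact: finite_image.
move=> p [p_ge0 pa].
have {}p_ge0 e : 0 <= p e by have := p_ge0 e; rewrite ffunE ler0z.
suff p_le : forall e, p e <= B.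
  exists [ffun e => inord `|p e|%N] => //; apply/ffunP => e; rewrite !ffunE.
  rewrite inordK ?gez0_abs// ltnS -lez_nat !gez0_abs//.
  exact: le_trans (p_le e).
move=> e; have -> : B = \sum_e (tgt e - src e)%:Z * p e.
  apply: (@intr_inj R); rewrite !raddf_sum /=.
  transitivity (\sum_(v < n.+1) \sum_(e : edge G)
      (n - v)%:R * (((src e == v)%:R - (tgt e == v)%:R) * (p e)%:~R) : R).
    apply: eq_bigr => v _; rewrite intrM -mulr_sumr; congr (_ * _).
    have := congr1 (fun M : 'cV[R]_n.+1 => M v 0) pa; rewrite !mxE => <-.
    rewrite (reindex (enum_val : 'I_#|edge G| -> edge G)) /=; last first.
      exact/onW_bij/enum_val_bij.
    by apply: eq_bigr => k _; rewrite !mxE ffunE.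
  rewrite exchange_big; apply: eq_bigr => e' _ /=.
  under eq_bigr do rewrite mulrA.
  rewrite -mulr_suml intrM; congr (_ * _).
  under eq_bigr do rewrite mulrBr.
  have pick (w : 'I_n.+1) :
      \sum_(v < n.+1) (n - v)%:R * (w == v)%:R = (n - w)%:R :> R.
    rewrite (bigD1 w)//= eqxx mulr1 big1 ?addr0// => v /negPf.
    by rewrite eq_sym => ->; rewrite mulr0.
  rewrite sumrB !pick -natrB ?leq_sub2l ?(ltnW (incG e'))//.
  by rewrite subnBA ?leq_ord// addnC addnBA ?leq_ord// subnAC addnK -pmulrn.
rewrite (bigD1 e) //= -[leLHS]addr0; apply: lerD.
  by rewrite ler_peMl// lez_nat subn_gt0 incG.
by apply: sumr_ge0 => e' _; rewrite mulr_ge0.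
Qed.

End Graph.

Arguments sigma_phi {n} G R a.
Arguments sigma_psi {n} G R a.

(* Main.v *)
Require Import Defs.
From mathcomp Require Import all_boot all_order all_algebra.
From mathcomp Require Import boolp classical_sets cardinality.
From mathcomp Require Import fsbigop reals polyrcf complex mpoly.
From mathcomp Require Import ring lra zify.

(** The coefficient [c u] of [N (sigma)] at [x^u / u!] counts the integral flows
    with sink values [u]; the polynomial is Lorentzian as soon as the support of
    [c] is M-convex and every matrix [(c (u + e_i + e_j))_(i, j)] has at most one
    positive eigenvalue.

    The support is M-convex because the difference of two flows is a
    circulation, in whose residual graph any sink edge losing flow is joined to
    one gaining flow.

    For the matrices, [c] is obtained from the point mass at the supply vector,
    a function on states in [N^(vertices + labels)], by applying for each edge
    the operator [transfer i j], which pushes arbitrarily many units from [i] to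
    [j].  Among strictly positive functions the eigenvalue condition is preserved
    by [transfer i j]: the matrix of the image is a sum of matrices [A_k] of the
    original function with [A_k e_i = A_(k+1) e_j], and telescoping the reverse
    Cauchy-Schwarz inequalities of the [A_k] gives that of the sum.  The point
    mass at [a] is the limit for [e -> 0] of the strictly positive weights
    [prod_i e^((u_i - a_i)^2)], which satisfy the condition, and the condition
    is closed under limits. *)

Set Implicit Arguments.
Unset Strict Implicit.
Unset Printing Implicit Defensive.

Import Order.TTheory GRing.Theory Num.Theory.

Local Open Scope ring_scope.

(** * Quadratic forms with at most one positive eigenvalue *)

Section Forms.
Variables (R : realFieldType) (N : nat).
Implicit Types (A : 'M[R]_N) (x y z : 'rV[R]_N) (t : R).

Definition form A x y : R := (x *m A *m y^T) 0 0.

Lemma formDl A x y z : form A (x + y) z = form A x z + form A y z.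
Proof. by rewrite /form !mulmxDl mxE. Qed.

Lemma formDr A x y z : form A z (x + y) = form A z x + form A z y.
Proof. by rewrite /form linearD /= mulmxDr mxE. Qed.

Lemma formZl A t x y : form A (t *: x) y = t * form A x y.
Proof. by rewrite /form -!scalemxAl mxE. Qed.

Lemma formZr A t x y : form A x (t *: y) = t * form A x y.
Proof. by rewrite /form linearZ /= -scalemxAr mxE. Qed.

Lemma formC A x y : A^T = A -> form A x y = form A y x.
Proof.
move=> symA; rewrite /form -[in LHS]symA.
by rewrite -[in LHS](trmxK x) -trmx_mul -trmx_mul mxE mulmxA.
Qed.

Lemma form_suml (I : finType) (A : I -> 'M[R]_N) x y :
  form (\sum_k A k) x y = \sum_k form (A k) x y.
Proof. by rewrite /form mulmx_sumr mulmx_suml summxE. Qed.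

Lemma formE A x y : form A x y = \sum_b \sum_c x 0 b * A b c * y 0 c.
Proof.
rewrite /form mxE exchange_big /=; apply: eq_bigr => c _.
by rewrite !mxE mulr_suml; apply: eq_bigr => b _.
Qed.

Lemma form_delta A x c : form A x (delta_mx 0 c) = \sum_b x 0 b * A b c.
Proof.
rewrite formE; apply: eq_bigr => b _; rewrite (bigD1 c) //= big1.
  by rewrite mxE !eqxx mulr1 addr0.
by move=> d /negPf ndc; rewrite mxE ndc andbF mulr0.
Qed.

Lemma form_delta2 A b c : form A (delta_mx 0 b) (delta_mx 0 c) = A b c.
Proof.
rewrite form_delta (bigD1 b) //= big1; first by rewrite mxE !eqxx mul1r addr0.
by move=> d /negPf ndc; rewrite mxE ndc andbF mul0r.
Qed.

(* For symmetric [A] this says that [A] has at most one positive eigenvalue; in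
   this form the condition is visibly preserved by limits. *)
Definition reverse_CS A : Prop :=
  forall x y, 0 < form A x x -> form A x x * form A y y <= form A x y ^+ 2.

(** Subtracting from [y] the multiple of [x] that brings it into the hyperplane gives a vector of
    nonpositive value; multiplied by [form A x x > 0], this is the claim up to a square. *)
Lemma reverse_CS_hyperplane A (u : 'cV[R]_N) : A^T = A ->
  (forall x, (x *m u) 0 0 = 0 -> form A x x <= 0) -> reverse_CS A.
Proof.
move=> symA A_le0 x y Axx.
have ux0 : (x *m u) 0 0 != 0.
  by apply: contraTneq Axx => /A_le0; rewrite leNgt.
set t := (y *m u) 0 0 / (x *m u) 0 0.
have := A_le0 (y + (- t) *: x).
rewrite mulmxDl -scalemxAl mxE [X in _ + X]mxE mulNr divfK // subrr.
move=> /(_ erefl).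
rewrite !(formDl, formDr, formZl, formZr) (formC y x symA).
move: (form A x x) (form A y y) (form A x y) Axx => p q r p0 le0.
have : p * (q - t * r + - t * (r - t * p)) <= 0.
  by rewrite pmulr_rle0 //; move: le0; lra.
by have := sqr_ge0 (r - t * p); rewrite !expr2; nra.
Qed.

End Forms.

(** The inequality survives pulling the form back along a linear map; this restricts it from all
    states to the label coordinates. *)
Lemma reverse_CS_mxsub (R : realFieldType) k l (f : 'I_k -> 'I_l)
  (A : 'M[R]_l) :
  reverse_CS A -> reverse_CS (mxsub f f A).
Proof.
move=> A_rcs x y.
have -> : mxsub f f A = rowsub f 1%:M *m A *m (rowsub f 1%:M)^T.
  rewrite -rowsubE; apply: trmx_inj; rewrite trmx_mul trmxK -rowsubE.
  by apply/matrixP => i j; rewrite !mxE.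
have formE (v w : 'rV[R]_k) : form (rowsub f 1%:M *m A *m (rowsub f 1%:M)^T) v w
    = form A (v *m rowsub f 1%:M) (w *m rowsub f 1%:M).
  by rewrite /form trmx_mul !mulmxA.
by rewrite !formE; exact: A_rcs.
Qed.

(** * Pushing units between variables *)

Section ChainInequality.
Variable R : realFieldType.
Implicit Types (f g h : nat -> R).

(* Downward induction along the chain; after the reverse Cauchy-Schwarz
   inequality at [q = G' / f 1], with [G'] the tail sum of [g], what remains
   is a square. *)
Lemma chain_tail_le (M : nat) f g h :
    (forall k, (k <= M)%N -> 0 < f k) ->
    (forall k q, (k <= M)%N ->
       f k * (h k + q * g k.+1 *+ 2 + q ^+ 2 * f k.+2)
         <= (g k + q * f k.+1) ^+ 2) ->
    f M.+1 = 0 -> f M.+2 = 0 -> g M.+1 = 0 ->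
  \sum_(k < M.+1) h k <= (\sum_(k < M.+1) g k) ^+ 2 / f 0%N
                         - (\sum_(k < M) g k.+1) ^+ 2 / f 1%N.
Proof.
elim: M f g h => [|M IH] f g h f_gt0 le_fgh f1 f2 g1.
  rewrite !big_ord1 big_ord0 expr0n mul0r subr0.
  have := le_fgh 0%N 0 isT; rewrite expr0n /= !mul0r mul0rn !addr0.
  by rewrite ler_pdivlMr ?f_gt0 // mulrC.
have f2_ge0 : 0 <= f 2%N.
  by case: M f1 f_gt0 {IH le_fgh f2 g1} => [->//|M _ f_gt0]; exact/ltW/f_gt0.
(* At the end of the chain [f 2 = 0] and the sum is empty, so division by zero does no harm. *)
have G2E : \sum_(k < M) g k.+2 = (\sum_(k < M) g k.+2) / f 2%N * f 2%N.
  case: M f_gt0 {IH le_fgh f1 f2 g1 f2_ge0} => [|M] f_gt0.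
    by rewrite big_ord0 !mul0r.
  by rewrite divfK // gt_eqF ?f_gt0.
have f0_gt0 : 0 < f 0%N by exact: f_gt0.
have f1_gt0 : 0 < f 1%N by exact: f_gt0.
have := IH (f \o succn) (g \o succn) (h \o succn) (fun k => f_gt0 k.+1)
  (fun k q => le_fgh k.+1 q) f1 f2 g1.
have recl (s : nat -> R) n : \sum_(k < n.+1) s k = s 0%N + \sum_(k < n) s k.+1.
  by rewrite big_ord_recl.
rewrite (recl h) (recl g) /= => {}IH.
set G1 := \sum_(k < M.+1) g k.+1 in IH *.
have G1E : G1 = g 1%N + \sum_(k < M) g k.+2 by rewrite /G1 (recl (g \o succn)).
have sq_div (x y : R) : x ^+ 2 / y = (x / y) ^+ 2 * y.
  by have [->|y0] := eqVneq y 0; [rewrite invr0 !mulr0 | field].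
have := le_fgh 0%N (G1 / f 1%N) isT; rewrite divfK ?gt_eqF // mulrC.
rewrite -ler_pdivlMr // => le0.
move: G1E G2E IH le0; set G2 := \sum_(k < M) g k.+2.
rewrite (sq_div G1 (f 1%N)) (sq_div G2 (f 2%N)).
have eG1 : G1 = G1 / f 1%N * f 1%N by rewrite divfK ?gt_eqF.
set X := (_ + _) ^+ 2 / _; set U1 := G1 / f 1%N in eG1 *.
set U2 := G2 / f 2%N => G1E G2E IH le0.
have eg : g 1%N = U1 * f 1%N - U2 * f 2%N by rewrite -eG1 -G2E G1E addrK.
have := mulr_ge0 f2_ge0 (sqr_ge0 (U1 - U2)).
by rewrite eg in le0; move: IH le0; nra.
Qed.
End ChainInequality.

(** In the application [f k], [g k], [h k] are the values of a form [A_k] at [(e_j, e_j)],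
    [(x, e_j)], [(x, x)], and the hypothesis in [q] is reverse Cauchy-Schwarz for [e_j] and
    [x + q e_i]. *)
Lemma chain_le (R : realFieldType) (M : nat) (f g h : nat -> R) :
    (forall k, (k <= M)%N -> 0 < f k) ->
    (forall k q, (k <= M)%N ->
       f k * (h k + q * g k.+1 *+ 2 + q ^+ 2 * f k.+2)
         <= (g k + q * f k.+1) ^+ 2) ->
    f M.+1 = 0 -> f M.+2 = 0 -> g M.+1 = 0 ->
  \sum_(k < M.+1) g k = 0 -> \sum_(k < M.+1) h k <= 0.
Proof.
move=> f_gt0 le_fgh f1 f2 g1 sg0.
apply: le_trans (chain_tail_le f_gt0 le_fgh f1 f2 g1) _.
rewrite sg0 expr0n mul0r sub0r oppr_le0 divr_ge0 ?sqr_ge0 //.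
by case: M f_gt0 f1 {le_fgh f2 g1 sg0} => [_ ->//|M f_gt0 _]; exact/ltW/f_gt0.
Qed.

Lemma addmAC N (u v w : 'X_{1..N}) : (u + v + w)%MM = (u + w + v)%MM.
Proof. by rewrite -!addmA (addmC v). Qed.

Section TransferDef.
Variables (N : nat) (V : nmodType).
Implicit Types (F : 'X_{1..N} -> V) (i j : 'I_N) (u : 'X_{1..N}).

Definition move_units i j k u : 'X_{1..N} := (u - U_(j) *+ k + U_(i) *+ k)%MM.

(* The state [u] collects the values at the states from which it is reached by
   pushing some number [k] of units from [i] to [j]. *)
Definition transfer i j F u : V := \sum_(k < (u j).+1) F (move_units i j k u).

Definition transfers (s : seq ('I_N * 'I_N)) F : 'X_{1..N} -> V :=
  foldr (fun ij => transfer ij.1 ij.2) F s.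

End TransferDef.

Section Transfer.
Variables (R : realFieldType) (N : nat).
Implicit Types (F : 'X_{1..N} -> R) (i j : 'I_N) (u : 'X_{1..N}).

(** When [F u] is the coefficient of [x^u / u!], this is the Hessian at the origin of the iterated
    derivative of order [u]. *)
Definition hess F u : 'M[R]_N := \matrix_(b, c) F (u + U_(b) + U_(c))%MM.

Lemma hess_sym F u : (hess F u)^T = hess F u.
Proof. by apply/matrixP => b c; rewrite !mxE addmAC. Qed.

(** Positivity is strict because the chain inequality divides by values of [F]. *)
Definition hyperbolic F : Prop :=
  (forall u, 0 < F u) /\ (forall u, reverse_CS (hess F u)).

(** Extension by zero puts the sums at neighbouring states over one common range of [k]. *)
Let term i j F u k : R := if (k <= u j)%N then F (move_units i j k u) else 0.

Let transfer_term i j F u n : (u j < n)%N ->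
  transfer i j F u = \sum_(k < n) term i j F u k.
Proof.
move=> lt_un; rewrite /transfer (big_ord_widen _ (fun k => F
  (move_units i j k u)) lt_un).
by rewrite big_mkcond; apply: eq_bigr => k _; rewrite ltnS.
Qed.

(** Both sides evaluate [F] at the same state: an extra unit at [i] amounts to one more unit taken
    back from [j]. *)
Let termS i j F u k : i != j ->
  term i j F (u + U_(i)) k = term i j F (u + U_(j)) k.+1.
Proof.
move=> nij; rewrite /term !mnmDE !mnm1E eqxx (negPf nij) addn0 addn1 ltnS.
case: leqP => // le_k; congr F; apply/mnmP => b.
rewrite !(mnmDE, mnmBE, mulmnE, mnm1E).
have [<-|njb] := eqVneq j b; first by rewrite (negPf nij); lia.
by case: eqVneq; lia.
Qed.

Lemma transfer_hyperbolic i j F : i != j -> hyperbolic F -> hyperbolic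
  (transfer i j F).
Proof.
move=> nij [F_gt0 F_rcs].
have t_gt0 u : 0 < transfer i j F u.
  rewrite /transfer big_ord_recl ltr_pwDl //.
  by apply: sumr_ge0 => k _; exact/ltW.
split=> // u; set K := u j.
pose A k : 'M[R]_N := \matrix_(b, c) term i j F (u + U_(b) + U_(c))%MM k.
have A_sym k : (A k)^T = A k.
  by apply/matrixP => b c; rewrite !mxE addmAC.
(* Two added units raise entry [j] to at most [K + 2], hence [K + 3] summands. *)
have hessE : hess (transfer i j F) u = \sum_(k < K.+3) A k.
  apply/matrixP => b c; rewrite summxE !mxE (@transfer_term _ _ _ _ K.+3).
    by apply: eq_bigr => k _; rewrite mxE.
  by rewrite !mnmDE !mnm1E /K; do 2 case: eqP => _; lia.
have A_shift k x : form (A k) x (delta_mx 0 i) = form (A k.+1) x (delta_mx 0 j).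
  by rewrite !form_delta; apply: eq_bigr => b _; rewrite !mxE termS.
pose f k := form (A k) (delta_mx 0 j) (delta_mx 0 j).
have fE k : f k = term i j F (u + U_(j) + U_(j))%MM k.
  by rewrite /f form_delta2 mxE.
have Aij k : form (A k) (delta_mx 0 i) (delta_mx 0 j) = f k.+1.
  by rewrite formC // A_shift.
have Aii k : form (A k) (delta_mx 0 i) (delta_mx 0 i) = f k.+2.
  by rewrite A_shift Aij.
have A_rcs k x : (k <= K.+2)%N ->
    f k * form (A k) x x <= form (A k) x (delta_mx 0 j) ^+ 2.
  (* Up to [K], [A k] is a matrix [hess F]. Beyond [K] only row and column [j] survive, so the form
     vanishes wherever coordinate [j] does. *)
  move=> le_k; case: (leqP k K) => [le_kK|lt_Kk].
    have eA : A k = hess F (move_units i j k u).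
      apply/matrixP => b c; rewrite !mxE /term !mnmDE.
      rewrite (leq_trans le_kK) -?addnA ?leq_addr //; congr F; apply/mnmP => a.
      rewrite !(mnmDE, mnmBE, mulmnE, mnm1E).
      have [<-|nja] := eqVneq j a; last by lia.
      by move: le_kK; rewrite /K; lia.
    have := F_rcs (move_units i j k u) (delta_mx 0 j) x.
    rewrite -eA (formC (delta_mx 0 j) x (A_sym k)) -/(f k); apply.
    rewrite fE /term !mnmDE !mnm1E eqxx !addn1 ifT ?F_gt0 //.
  have A0 (y : 'rV[R]_N) : y 0 j = 0 -> form (A k) y y = 0.
    move=> yj; rewrite formE big1 // => b _; rewrite big1 // => c _;
      rewrite mxE.
    have [->|nbj] := eqVneq b j; first by rewrite yj !mul0r.
    have [->|ncj] := eqVneq c j; first by rewrite yj mulr0.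
    rewrite /term !mnmDE !mnm1E (negPf nbj) (negPf ncj) !addn0 leqNgt lt_Kk /=.
    by rewrite mulr0 mul0r.
  have := A0 (x - x 0 j *: delta_mx 0 j).
  rewrite !mxE !eqxx mulr1 subrr => /(_ erefl).
  rewrite -scaleNr !(formDl, formDr, formZl, formZr) (formC (delta_mx 0 j) x
    (A_sym k)).
  rewrite -/(f k); move: (form _ x x) (form _ x (delta_mx 0 j)) => p q e.
  by have := sqr_ge0 (x 0 j * f k - q); rewrite !expr2; nra.
(* The hyperplane is the orthogonal of [e_j] for the summed form; on it the [g k] add up to zero. *)
apply: (@reverse_CS_hyperplane _ _ _ (hess (transfer i j F) u *m
  (delta_mx 0 j)^T)).
  exact: hess_sym.
move=> x; rewrite mulmxA -/(form _ _ _) hessE !form_suml.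
pose g k := form (A k) x (delta_mx 0 j).
have A_big k : (K.+2 < k)%N -> A k = 0.
  move=> lt_Kk; apply/matrixP => b c; rewrite !mxE /term !mnmDE !mnm1E.
  case: leqP => //; rewrite -/K; do 2 case: eqP => _; lia.
apply: (@chain_le _ K.+2 f g (fun k => form (A k) x x)).
- move=> k le_k; rewrite fE /term !mnmDE !mnm1E eqxx !addn1 le_k; exact: F_gt0.
- move=> k q le_k; have := A_rcs k (x + q *: delta_mx 0 i) le_k.
  rewrite !(formDl, formDr, formZl, formZr) Aij Aii (formC (delta_mx 0 i) x
    (A_sym k)) A_shift.
  by rewrite -/(g k) -/(g k.+1) mulr2n expr2 !addrA -!mulrA.
- by rewrite /f A_big // /form mulmx0 mul0mx mxE.
- by rewrite /f A_big // /form mulmx0 mul0mx mxE.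
- by rewrite /g A_big // /form mulmx0 mul0mx mxE.
Qed.

Lemma transfers_hyperbolic (s : seq ('I_N * 'I_N)) F :
  all (fun ij => ij.1 != ij.2) s -> hyperbolic F -> hyperbolic (transfers s F).
Proof.
by elim: s => //= -[i j] s IH /andP[nij sP] Fh; exact/transfer_hyperbolic/IH.
Qed.

(** With [r b] the ratio of consecutive weights, the matrix is [F u] times [r r^T] minus a diagonal
    matrix that log-concavity makes nonnegative; on the hyperplane orthogonal to [r] the first part
    vanishes. *)
Lemma prod_hyperbolic (w : 'I_N -> nat -> R) :
    (forall i k, 0 < w i k) ->
    (forall i k, w i k * w i k.+2 <= w i k.+1 ^+ 2) ->
  hyperbolic (fun u => \prod_i w i (u i)).
Proof.
move=> w_gt0 w_lc; set F := fun u => _.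
have F_gt0 u : 0 < F u by apply: prodr_gt0 => i _.
have FS u b : F (u + U_(b))%MM = F u * (w b (u b).+1 / w b (u b)).
  rewrite /F (bigD1 b) //= [\prod_i w i (u i)](bigD1 b) //=.
  rewrite mnmDE mnm1E eqxx addn1 (eq_bigr (fun i => w i (u i))).
    by field; rewrite gt_eqF.
  by move=> i nib; rewrite mnmDE mnm1E eq_sym (negPf nib) addn0.
split=> // u; pose r b := w b (u b).+1 / w b (u b).
apply: (@reverse_CS_hyperplane _ _ _ (\col_b r b)); first exact: hess_sym.
move=> x xr0; apply: (@le_trans _ _ (F u * (x *m \col_b r b) 0 0 ^+ 2));
  last first.
  by rewrite xr0 expr0n mulr0.
rewrite formE mxE expr2 mulrCA mulr_suml; apply: ler_sum => b _.
rewrite mulr_sumr mulr_sumr; apply: ler_sum => c _.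
rewrite !mxE FS FS -/(r b) mnmDE mnm1E.
have [<-|nbc] := eqVneq b c; last by rewrite addn0 -/(r c); lra.
rewrite addn1; have : w b (u b).+2 / w b (u b).+1 <= r b.
  by rewrite /r ler_pdivrMr // mulrAC ler_pdivlMr // -expr2 mulrC.
move: (w b _ / w b _) => t le_tr.
have := mulr_ge0 (mulr_ge0 (ltW (F_gt0 u)) (sqr_ge0 (x 0 b))) (ltW (divr_gt0
  (w_gt0 b (u b).+1) (w_gt0 b (u b)))).
rewrite -/(r b) => le0.
have := ler_wpM2l le0 le_tr; rewrite expr2; lra.
Qed.
End Transfer.

(** * Degeneration of positive weights to a point mass *)

Section Degeneration.
Variables (R : realType) (N : nat).

Lemma horner_transfers (s : seq ('I_N * 'I_N)) (F : 'X_{1..N} -> {poly R}) e u :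
  (transfers s F u).[e] = transfers s (fun v => (F v).[e]) u.
Proof.
elim: s u => //= ij s IH u.
by rewrite /transfer horner_sum; apply: eq_bigr => k _; exact: IH.
Qed.

Let gap (k l : nat) : nat := (k - l) + (l - k).

(** Convexity of the exponent makes [e ^ ((k - l) ^ 2)] log-concave in [k] for [0 < e <= 1]. *)
Lemma gap_convex k l : ((gap k.+1 l ^ 2).*2 <= gap k l ^ 2 + gap k.+2 l ^ 2)%N.
Proof. by rewrite /gap; case: (ltngtP k.+1 l) => ?; nia. Qed.

Lemma poly_gt0_near0 (p q : {poly R}) : 0 < p.[0] -> 0 < q.[0] ->
  exists e, [/\ 0 < e, e <= 1, 0 < p.[e] & 0 < q.[e]].
Proof.
move=> p0 q0; have [d1 d1_gt0 near1] := poly_cont 0 p p0.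
have [d2 d2_gt0 near2] := poly_cont 0 q q0.
pose e := Num.min (Num.min (d1 / 2) (d2 / 2)) 1.
have e_gt0 : 0 < e by rewrite !lt_min !divr_gt0 // ltr01.
have [le1 le2] : e <= d1 / 2 /\ e <= d2 / 2.
  by split; rewrite !ge_min lexx ?orbT.
exists e; split=> //; first by rewrite ge_min lexx orbT.
  have := near1 e; rewrite subr0 gtr0_norm // ltr_norml => near_e.
  have lt1 : e < d1 by lra.
  by have /andP[] := near_e lt1; lra.
have := near2 e; rewrite subr0 gtr0_norm // ltr_norml => near_e.
  have lt2 : e < d2 by lra.
by have /andP[] := near_e lt2; lra.
Qed.

(* The point mass at [a] is the limit, as [e] tends to [0], of the hyperbolic
   weights [\prod_i e ^ ((u i - a i) ^ 2)]. *)
Lemma transfers_delta_reverse_CS (s : seq ('I_N * 'I_N)) (a u : 'X_{1..N}) :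
  all (fun ij => ij.1 != ij.2) s ->
  reverse_CS (hess (transfers s (fun v => (v == a)%:R : R)) u).
Proof.
(* A violation consists of two strict inequalities between polynomials in [e] at [e = 0]; they
   persist at some small [e > 0], against hyperbolicity. *)
move=> sP x y; rewrite leNgt => xx; apply/negP.
pose F (v : 'X_{1..N}) : {poly R} := \prod_i 'X^(gap (v i) (a i) ^ 2).
pose G := transfers s F.
(* At [e = 0] the convention [0 ^+ 0 = 1] turns the weight into the point mass. *)
have G0 v : (G v).[0] = transfers s (fun v => (v == a)%:R : R) v.
  rewrite horner_transfers; congr transfers; apply/funext => {}v.
  rewrite horner_prod; under eq_bigr do rewrite hornerXn.
  have [->|/eqP nva] := eqVneq; first by rewrite big1 // => i _;
    rewrite /gap subnn expr0.
  have [i nvi] : exists i, v i != a i.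
    apply/existsP; rewrite -negb_forall; apply: contra_notN nva => /forallP va.
    by apply/mnmP => i; exact/eqP.
  rewrite (bigD1 i) //= expr0n (_ : (gap _ _ ^ 2 == 0)%N = false) ?mul0r //.
  by apply/negbTE; move: nvi; rewrite /gap; case: ltngtP => //; nia.
have G_hyp e : 0 < e -> e <= 1 -> hyperbolic (fun v => (G v).[e]).
  move=> e_gt0 e_le1.
  rewrite (_ : (fun _ => _) = transfers s (fun v => (F v).[e])); last first.
    by apply/funext => v; rewrite horner_transfers.
  apply: transfers_hyperbolic => //.
  rewrite (_ : (fun _ => _) = fun v : 'X_{1..N} => \prod_i e ^+ (gap (v i)
    (a i) ^ 2)).
    apply: (@prod_hyperbolic _ _ (fun i k => e ^+ (gap k (a i) ^ 2))) => i k.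
      exact: exprn_gt0.
    rewrite -exprD -exprM muln2; apply: ler_wiXn2l => //; first exact: ltW.
    exact: gap_convex.
  by apply/funext => v; rewrite horner_prod; under eq_bigr do rewrite hornerXn.
pose P (z t : 'rV[R]_N) : {poly R} :=
  \sum_b \sum_c (z 0 b * t 0 c)%:P * G (u + U_(b) + U_(c))%MM.
have PE e z t : (P z t).[e] = form (hess (fun v => (G v).[e]) u) z t.
  rewrite formE horner_sum; apply: eq_bigr => b _; rewrite horner_sum.
  by apply: eq_bigr => c _; rewrite hornerM hornerC !mxE; ring.
have G0E : transfers s (fun v => (v == a)%:R) = fun v => (G v).[0] :> R.
  by apply/funext => v; rewrite G0.
rewrite G0E -!PE in xx *; rewrite -subr_gt0 => lt0.
have [||e [e_gt0 e_le1]] := @poly_gt0_near0 (P x x)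
  (P x x * P y y - P x y ^+ 2) => //.
  by rewrite !hornerE.
rewrite !hornerE PE => /(proj2 (G_hyp e e_gt0 e_le1) u x y) le0.
by rewrite !PE subr_gt0 ltNge le0.
Qed.

End Degeneration.

(** * Counting positive eigenvalues *)

Section Spectrum.
Variables (R : realType) (m : nat).

Lemma eigenbasis_char_poly (K : fieldType) (A P : 'M[K]_m) (d : 'rV[K]_m) :
  P \in unitmx -> P *m A = diag_mx d *m P ->
  char_poly A = \prod_i ('X - (d 0 i)%:P).
Proof.
move=> Pu PA.
have -> : \prod_i ('X - (d 0 i)%:P) = char_poly (diag_mx d).
  rewrite char_poly_trig ?diag_mx_is_trig //.
  by apply: eq_bigr => i _; rewrite mxE eqxx mulr1n.
have PCu : map_mx polyC P \in unitmx by rewrite map_unitmx.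
have : map_mx polyC P *m char_poly_mx A = char_poly_mx
  (diag_mx d) *m map_mx polyC P.
  by rewrite /char_poly_mx mulmxBr mulmxBl -!map_mxM PA scalar_mxC.
move/(congr1 determinant); rewrite !det_mulmx mulrC => /mulIf; apply.
by rewrite det_map_mx polyC_eq0 -unitfE -unitmxE.
Qed.

(** The spectral theorem is applied over [R[i]]; the eigenvalues are real, and real matrices similar
    over [R[i]] are similar over [R]. *)
Lemma symmetric_eigenbasis (A : 'M[R]_m) : A^T = A ->
  exists (P : 'M[R]_m) (d : 'rV[R]_m),
    P \in unitmx /\ P *m A = diag_mx d *m P.
Proof.
move=> symA; pose toC := @real_complex_def R (Phant R).
pose AC := map_mx toC A.
have AC_real : AC \is a mxOver Num.real.
  by apply/mxOverP => i j; rewrite mxE complex_real.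
have AC_sym : AC \is symmetricmx.
  by apply/is_hermitianmxP; rewrite expr0 scale1r map_mx_id // /AC map_trmx
    symA.
have AC_herm := realsym_hermsym AC_sym AC_real.
have /orthomx_spectralP ACE := hermitian_normalmx AC_herm.
have D_real := hermitian_spectral_diag_real AC_herm.
have toC_Re k l (B : 'M[R[i]]_(k, l)) : B \is a mxOver Num.real ->
    map_mx toC (map_mx (@complex.Re R) B) = B.
  by move=> /mxOverP B_real; apply/matrixP => i j; rewrite !mxE;
    exact: RRe_real.
have diag_real : diag_mx (spectral_diag AC) \is a mxOver Num.real.
  apply/mxOverP => i j; rewrite mxE; case: eqP => _; last exact: real0.
  by rewrite mulr1n; apply: (mxOverP D_real).
have [Q /andP[Q_real Q_unit]] : similar_in [predI realmx & unitmx] AC (diag_mx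
  (spectral_diag AC)).
  apply: real_similar => //; exists (spectralmx AC); first exact: spectral_unit.
  apply/similarP; first exact: spectral_unit.
  by rewrite {2}ACE -mulmxA mulKVmx // spectral_unit.
move/(similarP Q_unit) => QA.
exists (map_mx (@complex.Re R) Q), (map_mx (@complex.Re R) (spectral_diag AC)).
split; first by rewrite -(map_unitmx toC) toC_Re.
apply: (@map_mx_inj _ _ toC).
by rewrite !map_mxM map_diag_mx !toC_Re.
Qed.

(** The rows of [P] need not be orthogonal. For two of them with positive eigenvalues, the
    inequality for [A] yields the same one for the dot product, contradicting strict Cauchy-Schwarz
    for independent vectors. *)
Lemma count_pos_eigenvalues_le1 (A : 'M[R]_m) :
  A^T = A -> reverse_CS A -> (count_pos_eigenvalues A <= 1)%N.
Proof.
move=> symA A_rcs; have [P [d [P_unit PA]]] := symmetric_eigenbasis symA.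
have eigen i : row i P *m A = d 0 i *: row i P.
  by rewrite -row_mul PA row_mul row_diag_mx -scalemxAl -rowE.
have norm_gt0 (v : 'rV[R]_m) : v != 0 -> 0 < form 1%:M v v.
  move=> v0; have [i vi] : exists i, v 0 i != 0 by apply/rV0Pn.
  rewrite /form mulmx1 mxE (bigD1 i) //= ltr_pwDl //.
    by rewrite mxE -expr2 exprn_even_gt0.
  by apply: sumr_ge0 => j _; rewrite mxE -expr2 sqr_ge0.
have dotC (x y : 'rV[R]_m) : form 1%:M x y = form 1%:M y x by
  rewrite formC ?trmx1.
have AE k x : form A (row k P) x = d 0 k * form 1%:M (row k P) x.
  by rewrite /form eigen -scalemxAl mxE mulmx1.
have comb_neq0 (x : 'rV[R]_m) : x != 0 -> x *m P != 0.
  apply: contra_neq => /(congr1 (mulmx^~ (invmx P))).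
  by rewrite mulmxK // mul0mx.
have rowE' k : row k P = delta_mx 0 k *m P by rewrite rowE.
have pos_uniq i j : 0 < d 0 i -> 0 < d 0 j -> i = j.
  move=> di dj; apply/eqP; apply/negPn/negP => nij.
  set v := row i P; set w := row j P.
  have v0 : v != 0.
    rewrite /v rowE' comb_neq0 //; apply/rV0Pn; exists i.
    by rewrite mxE !eqxx oner_neq0.
  have vv := norm_gt0 _ v0.
  have := A_rcs v w; rewrite !AE -/v -/w pmulr_rgt0 // => /(_ vv).
  have : d 0 i * form 1%:M v w = d 0 j * form 1%:M v w.
    by rewrite -(AE i) formC // AE dotC.
  (* A scaled Gram-Schmidt remainder; its squared norm brings in the Gram determinant of [v] and
     [w]. *)
  have z0 : form 1%:M v v *: w - form 1%:M v w *: v != 0.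
    rewrite /v /w !rowE' !scalemxAl -mulmxBl comb_neq0 //.
    apply/rV0Pn; exists j; rewrite !mxE !eqxx (eq_sym j)
      (negPf nij) mulr0 subr0 mulr1.
    by rewrite -rowE' gt_eqF.
  have := norm_gt0 _ z0.
  rewrite -scaleNr !(formDl, formDr, formZl, formZr) (dotC w v).
  move: (form _ v v) (form _ w w) (form _ v w) vv => a c b a_gt0.
  set z2 := (X in 0 < X); have -> : z2 = a * (a * c - b ^+ 2) by rewrite /z2;
    ring.
  rewrite pmulr_rgt0 // => lt0 e.
  have -> : (d 0 i * b) ^+ 2 = d 0 i * d 0 j * b ^+ 2 by rewrite expr2 {2}e;
    ring.
  rewrite mulrACA ler_pM2l ?mulr_gt0 // => le0; move: lt0.
  by rewrite subr_gt0 ltNge le0.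
rewrite /count_pos_eigenvalues (eigenbasis_char_poly P_unit PA).
apply: (@leq_trans (\sum_i (0 < d 0 i)%R)%N); last first.
  have [[i di]|d_le0] := pselect (exists i, 0 < d 0 i); last first.
    rewrite big1 // => i _; case: ltrP => // di; by case: d_le0; exists i.
  rewrite (bigD1 i) //= di big1 // => j nji.
  by case: ltrP => // dj; rewrite (pos_uniq i j) ?eqxx in nji.
have prod_neq0 (r : seq 'I_m) : \prod_(i <- r) ('X - (d 0 i)%:P) != 0.
  by rewrite prodf_seq_neq0; apply/allP => i _; rewrite polyXsubC_eq0.
have mup_prod x : mup x (\prod_i ('X - (d 0 i)%:P)) = (\sum_i (d 0%R i == x))%N.
  elim: (index_enum _) => [|i r IH].
    by rewrite !big_nil mupNroot // rootE hornerC oner_eq0.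
  rewrite !big_cons mupM ?polyXsubC_eq0 // IH -(expr1 ('X - _)) mup_XsubCX.
  by case: eqP.
under eq_bigr do rewrite mup_prod.
rewrite exchange_big /=; apply: leq_sum => i _.
set s := rootsR _; have s_uniq : uniq s by exact: uniq_roots.
case: (boolP (0 < d 0 i)) => di; last first.
  by rewrite big1 // => x x_gt0; case: eqP di => // ->; rewrite x_gt0.
rewrite big_mkcond; apply: (@leq_trans (\sum_(x <- s) (x == d 0%R i))%N).
  by apply: leq_sum => x _; rewrite eq_sym; case: ifP.
by rewrite -big_mkcond sum1_count count_uniq_mem // leq_b1.
Qed.

End Spectrum.

(** * Lorentzian polynomials by their coefficients *)

Section NormalizedCoefficients.
Variables (R : realType) (m : nat).
Implicit Types (c : 'X_{1..m} -> R) (f p : {mpoly R[m]}) (u v : 'X_{1..m}).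

Definition mfact u : nat := \prod_(i < m) (u i)`!.

Lemma mfact_gt0 u : (0 < mfact u)%N.
Proof. by apply: prodn_gt0 => i; exact: fact_gt0. Qed.

Lemma mfactS u i : mfact (u + U_(i))%MM = ((u i).+1 * mfact u)%N.
Proof.
rewrite /mfact (bigD1 i) //= [\prod_j (u j)`!](bigD1 i) //= mulnA -factS.
rewrite mnmDE mnm1E eqxx addn1; congr muln; apply: eq_bigr => j nji.
by rewrite mnmDE mnm1E eq_sym (negPf nji) addn0.
Qed.

Lemma mcoeff_normalize p u : (normalize p)@_u = p@_u / (mfact u)%:R.
Proof.
rewrite /normalize raddf_sum /=.
under eq_bigr do rewrite mcoeffZ mcoeffX.
case: (boolP (u \in msupp p)) => pu; last first.
  rewrite memN_msupp_eq0 // mul0r big_seq big1 // => v pv.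
  by case: eqP pv pu => [->->//|_ _ _]; rewrite mulr0.
rewrite (bigD1_seq u) //= eqxx mulr1 [X in _ + X]big1 ?addr0 // => v /negPf ->.
by rewrite mulr0.
Qed.

Lemma eq_Mconvex (J K : {pred 'X_{1..m}}) : J =i K -> Mconvex J -> Mconvex K.
Proof.
move=> eJK cJ i u v; rewrite -!eJK => Ju Jv lt_vu.
by have [j [? ? ?]] := cJ i u v Ju Jv lt_vu; exists j; rewrite -!eJK.
Qed.

(** The strict inequalities leave a unit to remove from [u] and [v] themselves, so truncated
    subtraction commutes with the shift. *)
Lemma Mconvex_shift (J : {pred 'X_{1..m}}) i :
  Mconvex J -> Mconvex [pred u | (u + U_(i))%MM \in J].
Proof.
move=> cJ a u v; rewrite !inE => Ju Jv lt_vu.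
have [|b [lt_b Jb Jb']] := cJ a _ _ Ju Jv; first by rewrite !mnmDE ltn_add2r.
rewrite !mnmDE ltn_add2r in lt_b; exists b; rewrite !inE; split=> //.
  rewrite (_ : (_ + U_(i))%MM = (u + U_(i) - U_(a) + U_(b))%MM) //.
  apply/mnmP => k; rewrite !(mnmDE, mnmBE, mnm1E).
  by have [<-|_] := eqVneq a k; move: lt_vu; lia.
rewrite (_ : (_ + U_(i))%MM = (v + U_(i) - U_(b) + U_(a))%MM) //.
apply/mnmP => k; rewrite !(mnmDE, mnmBE, mnm1E).
by have [<-|_] := eqVneq b k; move: lt_b; lia.
Qed.

(** Differentiation in the variable [i] shifts normalized coefficients to [c (u + U_(i))], and all
    the hypotheses are stable under this shift. *)
Lemma lorentzian_deg_coeffs d c f :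
    (forall u, f@_u = c u / (mfact u)%:R) ->
    (forall u, 0 <= c u) -> (forall u, c u != 0 -> mdeg u = d) ->
    Mconvex [pred u | c u != 0] -> (forall u, reverse_CS (hess c u)) ->
  lorentzian_deg d f.
Proof.
elim: d c f => [|d IH] c f fE c_ge0 c_deg c_conv c_rcs.
  exists (f@_0%MM); first by rewrite fE divr_ge0.
  apply/mpolyP => u; rewrite mcoeffC; have [->|u0] := eqVneq u 0%MM.
    by rewrite mulr1.
  rewrite fE mulr0 (_ : c u = 0) ?mul0r //; apply/eqP.
  by apply: contraNT u0 => /c_deg/eqP; rewrite mdeg_eq0.
have supp_f u : (u \in msupp f) = (c u != 0).
  by rewrite mcoeff_msupp fE mulf_eq0 invr_eq0 pnatr_eq0 eqn0Ngt mfact_gt0 orbF.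
have f_homog : f \is d.+1.-homog.
  by apply/dhomogP => u; rewrite supp_f => /c_deg.
have f_ge0 : nonneg_coeffs f by move=> u; rewrite fE divr_ge0.
have f_class : Mclass d.+1 f.
  by split=> //; apply: eq_Mconvex c_conv => u; rewrite !inE supp_f.
have dfE i u : f^`M(i)@_u = c (u + U_(i))%MM / (mfact u)%:R.
  rewrite mcoeff_mderiv fE mfactS natrM -mulr_natr.
  by field; rewrite nat1r !pnatr_eq0 -lt0n mfact_gt0.
have df_lorentzian i : lorentzian_deg d f^`M(i).
  apply: (IH (fun u => c (u + U_(i))%MM)) => //.
  - by move=> u /c_deg; rewrite mdegD mdeg1 addn1 => -[].
  - exact: Mconvex_shift c_conv.
  move=> u; rewrite (_ : hess _ _ = hess c (u + U_(i))%MM) //.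
  by apply/matrixP => a b; rewrite !mxE addmAC (addmAC u).
(* Degree 1 needs only homogeneity and signs, degree 2 the Hessian, and higher degrees the
   derivatives. *)
case: d {IH c_deg f_homog} f_class df_lorentzian => [|[|d]] f_class df_lor //.
  by case: f_class.
split=> //; rewrite (_ : hessian f = hess c 0%MM).
  by apply: count_pos_eigenvalues_le1; [exact: hess_sym | exact: c_rcs].
apply/matrixP => a b; rewrite !mxE mcoeff_mderiv dfE mnm0E add0m.
rewrite -[U_(b)%MM]add0m mfactS mnm0E mul1n /mfact big1 ?divr1 ?add0m;
  last first.
  by move=> i _; rewrite mnm0E.
by rewrite mulr1n addmC.
Qed.

End NormalizedCoefficients.

(** * Counting integral flows *)

Section CountingTransfers.
Variables (R : realType) (N D : nat) (E : finType) (s t : E -> 'I_N).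
Variable a : 'X_{1..N}.
Implicit Types (q : {ffun E -> 'I_D.+1}) (r : seq E) (u : 'X_{1..N}).

(* Only the balance between [a] and the final state [u] is recorded; the
   intermediate states may be negative, which [transfers_count] has to
   exclude. *)
Definition pushings r u : {set {ffun E -> 'I_D.+1}} :=
  [set q : {ffun E -> 'I_D.+1} | [forall e, (e \notin r) ==>
    (q e == 0%N :> nat)] &
    [forall i, u i + \sum_(e | s e == i) q e == a i + \sum_(e | t e == i) q
      e]%N].

Let set_at (e : E) (k : 'I_D.+1) q : {ffun E -> 'I_D.+1} :=
  [ffun e' => if e' == e then k else q e'].

Let sum_set_at e k q (P : pred E) : q e = 0%N :> nat ->
  (\sum_(e' | P e') set_at e k q e' = P e * k + \sum_(e' | P e') q e')%N.
Proof.
move=> qe; rewrite big_mkcond [in RHS]big_mkcond /=.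
rewrite (bigD1 e) //= [in RHS](bigD1 e) //= qe ffunE eqxx addnA.
congr (_ + _)%N; first by case: (P e); rewrite ?mul1n ?addn0.
by apply: eq_bigr => e' /negPf ne'; rewrite ffunE ne'.
Qed.

(** Removing [e] with its [k] units changes the balance at the two ends of [e] exactly as
    [move_units] changes the end state; [k <= u (t e)] makes the truncated subtraction exact. *)
Lemma pushings_cons e r u (k : 'I_D.+1) : e \notin r -> (k <= u (t e))%N ->
  [set q in pushings (e :: r) u | q e == k]
    = set_at e k @: pushings r (move_units (s e) (t e) k u).
Proof.
move=> er le_ku.
have moveE i : (move_units (s e) (t e) k u i + (t e == i) * k
    = u i + (s e == i) * k)%N.
  rewrite /move_units !(mnmDE, mnmBE, mulmnE, mnm1E).
  by have [<-|_] := eqVneq (t e) i; move: le_ku; case: eqVneq; lia.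
apply/setP => q; apply/idP/imsetP => [|[q' + ->]].
  rewrite !inE => /andP[/andP[/forallP q_supp /forallP q_eq] /eqP qe].
  exists (set_at e ord0 q); last first.
    by apply/ffunP => e'; rewrite !ffunE; case: eqP => [->|].
  have qE : q = set_at e k (set_at e ord0 q).
    by apply/ffunP => e'; rewrite !ffunE; case: eqP => [->|].
  have q0 : set_at e ord0 q e = 0%N :> nat by rewrite ffunE eqxx.
  rewrite inE; apply/andP; split; apply/forallP => i.
    have := q_supp i; rewrite inE ffunE; case: eqVneq => //= _.
    by rewrite implybT.
  have sumE (P : pred E) : (\sum_(e' | P e') q e'
    = P e * k + \sum_(e' | P e') set_at e ord0 q e')%N.
    by rewrite -sum_set_at // -qE.
  move: (q_eq i); rewrite !sumE; move/eqP => e1; apply/eqP.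
  by have := moveE i; lia.
rewrite !inE => /andP[/forallP q_supp /forallP q_eq].
have q0 : q' e = 0%N :> nat by have := q_supp e; rewrite er /= => /eqP.
rewrite ffunE !eqxx andbT; apply/andP; split; apply/forallP => i.
  rewrite inE ffunE; case: eqVneq => //= _; exact: q_supp.
move: (q_eq i); rewrite !sum_set_at //; move/eqP => e1; apply/eqP.
by have := moveE i; lia.
Qed.

(** Induction on the edges, sorting by the value at the first one. The last hypothesis says that no
    flow is lost to the bound [k <= u j] in [transfer]. *)
Lemma transfers_count r u : uniq r -> (mdeg u <= D)%N ->
    (forall q, q \in pushings r u -> forall i, (\sum_e q e <= u i)%N) ->
  transfers [seq (s e, t e) | e <- r] (fun v => (v == a)%:R : R) u
    = #|pushings r u|%:R.
Proof.
elim: r u => [|e r IH] u /= => [_ _ _|/andP[er r_uniq] le_uD small].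
  have sum0 (P : pred E) : (\sum_(e | P e) ([ffun=> ord0] : {ffun E
    -> 'I_D.+1}) e = 0)%N.
    by rewrite big1 // => e _; rewrite ffunE.
  have [-> | nua] := eqVneq u a.
    rewrite (_ : pushings _ _ = [set [ffun=> ord0]]) ?cards1 //.
    apply/setP => q; rewrite !inE; apply/andP/eqP => [[/forallP q0 _]|->].
      by apply/ffunP => e; rewrite ffunE; apply/val_inj/eqP; exact: q0.
    split; apply/forallP => i; first by rewrite ffunE.
    by rewrite !sum0.
  rewrite (_ : pushings _ _ = finset.set0) ?cards0 //.
  apply/setP => q; rewrite !inE; apply/negbTE/negP
    => /andP[/forallP q0 /forallP qE].
  case/eqP: nua; apply/mnmP => i; have /eqP := qE i.
  have -> : q = [ffun=> ord0].
    by apply/ffunP => e; rewrite ffunE; apply/val_inj/eqP; exact: q0.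
  by rewrite !sum0 !addn0.
have le_u i : (u i <= D)%N.
  by apply: leq_trans le_uD; rewrite mdegE (bigD1 i) //= leq_addr.
pose at_ (k : 'I_D.+1) := [set q in pushings (e :: r) u | q e == k].
have at_card (k : 'I_D.+1) : (k <= u (t e))%N ->
    #|at_ k| = #|pushings r (move_units (s e) (t e) k u)|.
  move=> le_ku; rewrite /at_ pushings_cons // card_in_imset // => q q'.
  rewrite !inE => /andP[/forallP/(_ e) q0 _] /andP[/forallP/(_ e) q'0 _] qq'.
  apply/ffunP => e'; have := congr1 (fun f : {ffun E -> 'I_D.+1} => f e') qq'.
  rewrite !ffunE; case: eqP => // -> _; apply/val_inj.
  by move: q0 q'0; rewrite er /= => /eqP-> /eqP->.
have at_big (k : 'I_D.+1) : (u (t e) < k)%N -> #|at_ k| = 0%N.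
  move=> lt_uk; rewrite (_ : at_ k = finset.set0) ?cards0 //.
  apply/setP => q; rewrite [RHS]inE inE;
    apply/negP => /andP[/small/(_ (t e)) le_q /eqP qe].
  by move: le_q; rewrite (bigD1 e) //= qe; lia.
rewrite -sum1_card.
rewrite (partition_big (fun q : {ffun E -> 'I_D.+1} => q e) xpredT) //=.
rewrite natr_sum; under [RHS]eq_bigr => k _.
  rewrite (_ : (\sum_(q in _ | _) _ = #|at_ k|)%N); last first.
    by rewrite -sum1_card; apply: eq_bigl => q; rewrite [in RHS]inE.
  over.
rewrite /transfer (big_ord_widen D.+1 (fun k => transfers _ _ (move_units
  (s e) (t e) k u))) ?ltnS //.
rewrite big_mkcond; apply: eq_bigr => k _; rewrite ltnS.
case: leqP => [le_ku|/at_big->//]; rewrite at_card //; apply: IH => //.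
  apply: leq_trans le_uD; rewrite /move_units mdegD mdegMn mdeg1 mul1n.
  have := mdegD (u - U_(t e) *+ k)%MM (U_(t e) *+ k)%MM.
  rewrite submK; last first.
    by apply/mnm_lepP => i; rewrite mulmnE mnm1E; case: eqP => [<-|]; lia.
  by rewrite mdegMn mdeg1; lia.
(* The state loses at most [k] units at any place, while the total flow loses the [k] units of [e],
   so the bound is inherited. *)
move=> q q_in i.
have : set_at e k q \in pushings (e :: r) u.
  have : set_at e k q \in at_ k by rewrite /at_ pushings_cons // imset_f.
  by rewrite inE => /andP[].
move/small/(_ i); rewrite sum_set_at; last first.
  by move: q_in; rewrite inE => /andP[/forallP/(_ e)]; rewrite er /= => /eqP.
rewrite mul1n /move_units !(mnmDE, mnmBE, mulmnE, mnm1E).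
by case: (t e == i); case: (s e == i); lia.
Qed.

End CountingTransfers.

Section LatticePoints.
Variables (R : realType) (n m : nat) (G : multigraph n) (a : 'cV[int]_n.+1).
Hypothesis G_increasing : increasing G.
Implicit Types (p q : {ffun edge G -> int}) (u : 'X_{1..m}).

Definition balanced p (v : 'I_n.+1) : Prop :=
  \sum_(e | src e == v) p e = a v 0 + \sum_(e | tgt e == v) p e.

Lemma lattice_pointsP p : lattice_points R a p <->
  (forall e, 0 <= p e) /\ (forall v, balanced p v).
Proof.
have row_eq v : (incidence_mx G R *m \col_k [ffun e => (p e)%:~R]
  (enum_val k)) v 0
   = (\sum_(e | src e == v) p e - \sum_(e | tgt e == v) p e)%:~R.
  rewrite mxE intrB !raddf_sum /=.
  rewrite [X in _ = X + _]big_mkcond [X in _ = _ + X]big_mkcond -big_split.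
  rewrite [RHS](reindex (enum_val : 'I_#|edge G| -> edge G)) /=; last first.
    exact/onW_bij/enum_val_bij.
  apply: eq_bigr => k _; rewrite !mxE ffunE.
  by do 2 case: eqP => _; rewrite ?subr0 ?sub0r ?subrr ?mul1r ?mul0r ?mulN1r
    ?addr0 ?add0r ?subrr.
split=> [[p_ge0 pa]|[p_ge0 pa]].
  split=> [e|v]; first by have := p_ge0 e; rewrite ffunE ler0z.
  have := congr1 (fun M : 'cV[R]_n.+1 => M v 0) pa.
  by rewrite row_eq mxE /balanced => /intr_inj <-; rewrite subrK.
split=> [e|]; first by rewrite ffunE ler0z.
by apply/matrixP => v k; rewrite ord1 row_eq mxE pa addrK.
Qed.

Lemma src_neq_max (e : edge G) : (src e == ord_max) = false.
Proof.
apply/negbTE/eqP => se; have := G_increasing e; rewrite se.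
by rewrite ltnNge -ltnS ltn_ord.
Qed.

Lemma lattice_points_bounded : exists B : nat,
  forall p, lattice_points R a p -> forall e, (`|p e| <= B)%N.
Proof.
have /finite_seqP[s sE] := @finite_lattice_points n G R a G_increasing.
exists (\max_(p <- s) \max_e `|p e|)%N => p; rewrite sE /= => ps e.
apply: leq_trans (leq_bigmax_seq _ ps isT).
exact: (leq_bigmax e).
Qed.

(* The labels index the variables: an edge is labelled when it enters the sink.
   Labelling such an edge by itself gives [sigma_phi], by its source
   [sigma_psi]. *)
Section Labels.
Variable lab : edge G -> option 'I_m.

Definition label_exponent p : 'X_{1..m} :=
  [multinom `|(\sum_(e | lab e == Some k) p e)%R|%N | k < m].

Definition sigma_lab : {mpoly R[m]} :=
  \sum_(p \in lattice_points R a) ('X_[label_exponent p] : {mpoly R[m]}).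

Definition flowZ D (q : {ffun edge G -> 'I_D.+1}) : {ffun edge G -> int} :=
  [ffun e => (q e)%:Z].

(** Bounded values give a finite type, in which lattice points can be counted. *)
Definition flows D : {set {ffun edge G -> 'I_D.+1}} :=
  [set q : {ffun edge G -> 'I_D.+1} | `[< lattice_points R a (flowZ q) >]].

Lemma lattice_points_flows B D :
    (forall p, lattice_points R a p -> forall e, (`|p e| <= B)%N) ->
      (B <= D)%N ->
  lattice_points R a = (@flowZ D @` [set` flows D])%classic.
Proof.
move=> B_max le_BD.
apply/seteqP; split=> [p Lp|p [q /= + <-]]; last by rewrite inE => /asboolP.
have pE : @flowZ D [ffun e => inord `|p e|%N] = p.
  apply/ffunP => e; rewrite !ffunE inordK; last first.
    by rewrite ltnS (leq_trans (B_max p Lp e)).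
  by rewrite gez0_abs //; apply: (proj1 (lattice_pointsP p) Lp).1.
by exists [ffun e => inord `|p e|%N] => //=; rewrite inE; apply/asboolP;
  rewrite pE.
Qed.

Lemma sigma_labE B D :
    (forall p, lattice_points R a p -> forall e, (`|p e| <= B)%N) ->
      (B <= D)%N ->
  sigma_lab = \sum_(q in flows D) ('X_[label_exponent
    (flowZ q)] : {mpoly R[m]}).
Proof.
move=> B_max le_BD; rewrite /sigma_lab (lattice_points_flows B_max le_BD).
rewrite fsbig_image; last first.
  move=> q q' _ _ /ffunP qq'; apply/ffunP => e; apply/val_inj.
  by have := qq' e; rewrite !ffunE => -[].
rewrite -(@bigfs _ _ _ _ (index_enum _)) // ?index_enum_uniq // => q _.
by rewrite mem_index_enum.
Qed.

Lemma mcoeff_sigma_lab B D u :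
    (forall p, lattice_points R a p -> forall e, (`|p e| <= B)%N) ->
      (B <= D)%N ->
  sigma_lab@_u
    = #|[set q in flows D | label_exponent (flowZ q) == u]|%:R.
Proof.
move=> B_max le_BD; rewrite (sigma_labE B_max le_BD) raddf_sum -sum1_card.
rewrite natr_sum /= big_mkcond [RHS]big_mkcond; apply: eq_bigr => q _.
rewrite mcoeffX [in RHS]inE; case: (q \in _) => //=; first by case: eqP.
Qed.

Hypothesis labP : forall e, isSome (lab e) = (tgt e == ord_max).

Lemma label_exponentP p k : lattice_points R a p ->
  (label_exponent p k)%:Z = \sum_(e | lab e == Some k) p e.
Proof.
move=> /lattice_pointsP[p_ge0 _]; rewrite mnmE gez0_abs //.
by apply: sumr_ge0 => e _.
Qed.

(** The labels partition the edges into the sink, and the balance at the sink fixes their total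
    flow. *)
Lemma mdeg_label_exponent p : lattice_points R a p ->
  mdeg (label_exponent p) = `|(a ord_max 0)%R|%N.
Proof.
move=> Lp; have [_ /(_ ord_max)] := proj1 (lattice_pointsP p) Lp.
rewrite /balanced big_pred0; last by move=> e; rewrite src_neq_max.
move=> bal; suff eq_deg : (mdeg (label_exponent p))%:Z
  = \sum_(e | tgt e == ord_max) p e.
  by move: bal; rewrite -eq_deg; lia.
rewrite mdegE -natz natr_sum.
under eq_bigr do rewrite natz label_exponentP // big_mkcond.
rewrite exchange_big /= [RHS]big_mkcond; apply: eq_bigr => e _; rewrite -labP.
case: (lab e) => [k|] /=; last by rewrite big1.
rewrite (bigD1 k) //= eqxx big1 ?addr0 // => k' /negPf nkk'.
by rewrite (inj_eq Some_inj) eq_sym nkk'.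
Qed.

Let N := (n.+1 + m)%N.
Let s (e : edge G) : 'I_N := lshift m (src e).
(** A labelled edge is redirected from the sink to its label, where the exponent accumulates. *)
Let t (e : edge G) : 'I_N :=
  if lab e is Some k then rshift n.+1 k else lshift m (tgt e).

(* Both states are shifted by a constant [C], large enough for the truncation
   in [transfer] at nonnegative states to be irrelevant. *)
Definition start_state (C : nat) : 'X_{1..N} :=
  [multinom match fintype.split i with
            | inl v => C + (if v == ord_max then 0 else `|(a v 0)%R|)
            | inr _ => C
            end%N | i < N].

Definition end_state (C : nat) u : 'X_{1..N} :=
  [multinom match fintype.split i with
            | inl _ => C
            | inr k => C + u k
            end%N | i < N].

(** After redirection the sink is isolated. The equations at the other vertices are conservation,
    and those at the labels fix the exponents. *)
Lemma pushings_flows D C u (q : {ffun edge G -> 'I_D.+1}) :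
    (forall v : 'I_n.+1, v != ord_max -> 0 <= a v 0) -> \sum_v a v 0 = 0 ->
  (q \in pushings D s t (start_state C) (enum (edge G)) (end_state C u))
    = (q \in flows D) && (label_exponent (flowZ q) == u).
Proof.
move=> a_ge0 a_sum; set p := flowZ q.
have sumZ (P : pred (edge G)) : \sum_(e | P e) p e = (\sum_(e | P e) q e)%N%:Z.
  by rewrite -natz natr_sum; apply: eq_bigr => e _; rewrite ffunE natz.
have s_r (k : 'I_m) : (\sum_(e | s e == rshift n.+1 k) q e = 0)%N.
  by rewrite big_pred0 // => e; rewrite eq_lrshift.
have s_l v : (\sum_(e | s e == lshift m v) q e = \sum_(e | src e == v) q e)%N.
  by apply: eq_bigl => e; rewrite eq_lshift.
have t_r (k : 'I_m) : (\sum_(e | t e == rshift n.+1 k) q e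
  = \sum_(e | lab e == Some k) q e)%N.
  apply: eq_bigl => e; rewrite /t; case: (lab e) => [k'|].
    by rewrite eq_rshift (inj_eq Some_inj).
  by rewrite eq_lrshift.
have t_l v : v != ord_max ->
    (\sum_(e | t e == lshift m v) q e = \sum_(e | tgt e == v) q e)%N.
  move=> vmax; apply: eq_bigl => e; rewrite /t; have := labP e.
  case: (lab e) => [k|] /esym; last by rewrite eq_lshift.
  by rewrite eq_rlshift => /eqP ->; rewrite eq_sym (negPf vmax).
have t_max : (\sum_(e | t e == lshift m ord_max) q e = 0)%N.
  rewrite big_pred0 // => e; rewrite /t; have := labP e.
  by case: (lab e) => [k|] /= /esym; [rewrite eq_rlshift | rewrite eq_lshift].
have src_max : (\sum_(e | src e == ord_max) q e = 0)%N.
  by rewrite big_pred0 // => e; rewrite src_neq_max.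
rewrite inE; apply/andP/andP.
  move=> [_ /forallP eqs]; have bal : lattice_points R a p.
    apply/lattice_pointsP; split=> [e|]; first by rewrite ffunE.
    have bal v : v != ord_max -> balanced p v.
      move=> vmax; rewrite /balanced !sumZ; have /eqP := eqs (lshift m v).
      rewrite s_l t_l // !mnmE !(unsplitK (inl _)) (negPf vmax).
      by have := a_ge0 v vmax; lia.
    move=> v; have [->|] := eqVneq v ord_max; last exact: bal.
    have sum_fiber (f : edge G -> 'I_n.+1) : \sum_v \sum_(e | f e == v) p e
      = \sum_e p e.
      by rewrite [RHS](partition_big f xpredT).
    (* Balance at the sink follows by summing over all vertices, since the supplies add up to
       zero. *)
    have : \sum_v \sum_(e | src e == v) p e
           = \sum_v (a v 0 + \sum_(e | tgt e == v) p e).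
      by rewrite big_split /= a_sum add0r !sum_fiber.
    rewrite (bigD1 ord_max) //= [RHS](bigD1 ord_max) //=.
    by rewrite (eq_bigr _ bal) => /addIr.
  split; first by rewrite inE; apply/asboolP.
  apply/eqP/mnmP => k; have /eqP := eqs (rshift n.+1 k).
  rewrite s_r t_r !mnmE !(unsplitK (inr _)) -/p sumZ; lia.
rewrite inE => -[/asboolP Lp /eqP uE]; split.
  by apply/forallP => e; rewrite mem_enum.
apply/forallP => i; apply/eqP; rewrite !mnmE.
case: (splitP i) => [v iv|k ik].
  have -> : i = lshift m v by apply/val_inj.
  rewrite s_l; have [->|vmax] := eqVneq v ord_max.
    by rewrite src_max t_max !addn0.
  have [_ /(_ v)] := proj1 (lattice_pointsP _) Lp.
  rewrite /balanced !sumZ t_l //; have := a_ge0 v vmax; lia.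
have -> : i = rshift n.+1 k by apply/val_inj.
by rewrite s_r t_r; have := label_exponentP k Lp; rewrite uE sumZ; lia.
Qed.

(** [C] bounds the total flow of every lattice point. It must not depend on [u], as all entries of a
    Hessian are read off one function; [D] may depend on [u]. *)
Lemma sigma_lab_transfers : exists C, forall u,
    (forall v : 'I_n.+1, v != ord_max -> 0 <= a v 0) -> \sum_v a v 0 = 0 ->
  sigma_lab@_u = transfers [seq (s e, t e) | e <- enum (edge G)]
    (fun v => (v == start_state C)%:R) (end_state C u).
Proof.
have [B B_max] := lattice_points_bounded.
exists (#|edge G| * B)%N => u a_ge0 a_sum; set C := (_ * _)%N.
pose D := maxn B (mdeg (end_state C u)).
rewrite (@mcoeff_sigma_lab B D) ?leq_maxl //
  (@transfers_count _ _ D) ?leq_maxr ?enum_uniq //.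
  by congr (_%:R); apply: eq_card => q; rewrite pushings_flows // inE.
move=> q; rewrite pushings_flows // inE => /andP[/asboolP Lq _] i.
apply: (@leq_trans C).
  rewrite /C -sum_nat_const; apply: leq_sum => e _.
  by have := B_max _ Lq e; rewrite ffunE.
by rewrite mnmE; case: fintype.split => // k; exact: leq_addr.
Qed.

Lemma sigma_lab_reverse_CS u : (forall v : 'I_n.+1, v != ord_max
  -> 0 <= a v 0) ->
  \sum_v a v 0 = 0 -> reverse_CS (hess (fun v => sigma_lab@_v) u).
Proof.
move=> a_ge0 a_sum; have [C sigmaE] := sigma_lab_transfers.
set F := transfers [seq (s e, t e) | e <- enum (edge G)] (fun v =>
  (v == start_state C)%:R : R).
rewrite (_ : hess _ u = mxsub (@rshift n.+1 m) (@rshift n.+1 m) (hess F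
  (end_state C u))).
  apply: reverse_CS_mxsub; apply: transfers_delta_reverse_CS.
  apply/allP => _ /mapP[e _ ->] /=; rewrite /s /t.
  case: (lab e) => [k|]; first by rewrite eq_lrshift.
  by rewrite eq_lshift; apply: contraTneq (G_increasing e) => ->; rewrite ltnn.
apply/matrixP => b c; rewrite !mxE sigmaE //; congr (transfers _ _ _).
apply/mnmP => i; rewrite !(mnmDE, mnmE, mnm1E).
case: splitP => [v iv|k ik].
  have -> : i = lshift m v by apply/val_inj.
  by rewrite !eq_rlshift !addn0.
have -> : i = rshift n.+1 k by apply/val_inj.
by rewrite !eq_rshift !mnmDE !mnm1E !addnA.
Qed.

End Labels.
End LatticePoints.

(** * Exchange along residual paths *)

Section Exchange.
Variables (n m : nat) (G : multigraph n) (lab : edge G -> option 'I_m).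
Hypothesis G_increasing : increasing G.
Hypothesis labP : forall e, isSome (lab e) = (tgt e == ord_max).
Hypothesis lab_src :
  forall e e', isSome (lab e) -> lab e = lab e' -> src e = src e'.
Variable d : edge G -> int.
Hypothesis d_circulation :
  forall v, \sum_(e | src e == v) d e = \sum_(e | tgt e == v) d e.

(** For [d = q - p] with [p] and [q] nonnegative, this keeps [p + x] and [q - x] nonnegative. *)
Definition conformal (x : edge G -> int) : Prop :=
  forall e, (0 <= x e <= d e) || (d e <= x e <= 0).

(** Steps along which a unit can be sent conformally without touching any label. *)
Definition residual : rel 'I_n.+1 := fun v w =>
  [exists e, ~~ isSome (lab e) &&
    (((src e == v) && (tgt e == w) && (0 < d e))
     || ((tgt e == v) && (src e == w) && (d e < 0)))].

Let sum_point (P : pred (edge G)) e (c : int) :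
  \sum_(e' | P e') (if e' == e then c else 0) = if P e then c else 0.
Proof.
rewrite big_mkcond (bigD1 e) //= eqxx big1 ?addr0 // => e' /negPf ->.
by case: ifP.
Qed.

(** As no vertex repeats, each edge is used at most once and carries at most one unit, which stays
    conformal because [d] is integral. *)
Lemma residual_path_flow v (r : seq 'I_n.+1) :
  path residual v r -> uniq (v :: r) ->
  exists x : edge G -> int, [/\ conformal x,
    forall e, x e != 0 -> [&& ~~ isSome
      (lab e), src e \in v :: r & tgt e \in v :: r] &
    forall w, \sum_(e | src e == w) x e - \sum_(e | tgt e == w) x e
      = (v == w)%:R - (last v r == w)%:R].
Proof.
elim: r v => [|w r IH] v.
  move=> _ _; exists (fun=> 0); split=> // [e|w].
    by rewrite !lexx andbT /= le_total.
  by rewrite !big1 // subrr /= subrr.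
move=> /andP[/existsP[e /andP[e_lab e_res]] r_path] /andP[v_r r_uniq].
have [x [x_conf x_supp x_bnd]] := IH w r_path r_uniq.
pose c : int := if 0 < d e then 1 else -1.
have xe0 : x e = 0.
  apply/eqP; apply: contraNT v_r => /x_supp/and3P[_ se te].
  by case/orP: e_res => /andP[/andP[/eqP<- _] _].
exists (fun e' => x e' + if e' == e then c else 0); split=> [e'|e'|u].
- have [->|_] := eqVneq e' e; last by rewrite addr0; exact: x_conf.
  by rewrite xe0 add0r /c; case/orP: e_res => /andP[_ de]; case: ltrP; lia.
- have [->_|_] := eqVneq e' e; last first.
    rewrite addr0 => /x_supp/and3P[-> se te] /=.
    by rewrite !(in_cons v) se te !orbT.
  rewrite e_lab /=; case/orP: e_res => /andP[/andP[/eqP-> /eqP->] _];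
  by rewrite !inE !eqxx !orbT.
rewrite !big_split /= !sum_point opprD addrACA x_bnd /c.
case/orP: e_res => /andP[/andP[/eqP-> /eqP->] de].
  by rewrite de; do 3 case: eqP => _; lia.
by rewrite ltNge (ltW de) /=; do 3 case: eqP => _; lia.
Qed.

(** Otherwise let [W] be the set reached from [src e0]. The net outflow of the circulation from [W]
    is zero, yet unlabelled edges and labels other than [i] contribute nothing positive and label
    [i] is strictly negative. *)
Lemma residual_reaches_label (e0 : edge G) (i : 'I_m) :
    lab e0 = Some i -> \sum_(e | lab e == Some i) d e < 0 ->
  exists e1 j, [/\ lab e1 = Some j, 0 < \sum_(e | lab e == Some j) d e,
    0 < d e1 & connect residual (src e0) (src e1)].
Proof.
move=> e0_lab neg_i; apply: contrapT => no_e1.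
pose W w := connect residual (src e0) w.
(* Forward steps use unlabelled edges and backward steps end at a source; neither arrives at the
   sink. *)
have W_max : W ord_max = false.
  apply/negbTE/negP => /connectP[r r_path r_last].
  have : last (src e0) r != ord_max.
    have : src e0 != ord_max by rewrite src_neq_max.
    elim: r (src e0) r_path {r_last} => //= w r IH v /andP[/existsP[e]].
    rewrite labP => /andP[te e_res] r_path _; apply: IH => //.
    case/orP: e_res => /andP[/andP[/eqP _ /eqP <-] _] //.
    by rewrite src_neq_max.
  by rewrite -r_last eqxx.
have no_j j e : lab e = Some j -> W (src e)
  -> \sum_(e | lab e == Some j) d e <= 0.
  move=> e_lab We; rewrite leNgt; apply/negP => pos_j.
  have [e1 e1_lab de1] : exists2 e1, lab e1 == Some j & 0 < d e1.
    apply: contrapT => no_pos; move: pos_j; rewrite ltNge => /negP; apply.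
    by apply: sumr_le0 => e1 e1_lab; rewrite leNgt; apply/negP => ?;
      apply: no_pos; exists e1.
  apply: no_e1; exists e1, j; split=> //; first exact/eqP.
  by rewrite -(@lab_src e e1) ?e_lab // (eqP e1_lab).
have : 0 = \sum_e ((W (src e))%:R * d e - (W (tgt e))%:R * d e).
  have fiber (f : edge G -> 'I_n.+1) : \sum_e (W (f e))%:R * d e
    = \sum_(v | W v) \sum_(e | f e == v) d e.
    rewrite (eq_bigr (fun e => if W (f e) then d e else 0)).
      by rewrite -big_mkcond (partition_big f W) //=; apply: eq_bigr => v Wv;
        apply: eq_bigl => e; case: eqP => [->|]; rewrite ?Wv ?andbF.
    by move=> e _; case: (W _); rewrite ?mul1r ?mul0r.
  rewrite sumrB !fiber; apply/esym/eqP; rewrite subr_eq0; apply/eqP.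
  by apply: eq_bigr => v _; exact: d_circulation.
apply/eqP; rewrite gt_eqF //.
have split_lab e : (W (src e))%:R * d e - (W (tgt e))%:R * d e
     <= \sum_j if lab e == Some j then (W (src e))%:R * d e else 0.
  have := labP e; case e_lab: (lab e) => [k|] /= /esym.
    move=> /eqP ->; rewrite W_max mul0r subr0 (bigD1 k) //= eqxx big1 ?addr0 //.
    by move=> j /negPf njk; rewrite (inj_eq Some_inj) eq_sym njk.
  move=> _; rewrite big1 // -mulrBl.
  have step v w : residual v w -> W v -> W w.
    by move=> /connect1 vw Wv; exact: connect_trans vw.
  case Ws: (W (src e)); case Wt: (W (tgt e));
    rewrite ?subrr ?mul0r // ?subr0 ?sub0r ?mul1r ?mulN1r ?oppr_le0 leNgt.
    apply: contraFN Wt => de; apply: step Ws; apply/existsP; exists e.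
    by rewrite e_lab !eqxx de.
  apply: contraFN Ws => de; apply: step Wt; apply/existsP; exists e.
  by rewrite e_lab !eqxx de orbT.
apply: le_lt_trans (ler_sum _ (fun e _ => split_lab e)) _.
rewrite exchange_big /= (bigD1 i) //=.
(* By [lab_src], whether the source lies in [W] depends on the label only, so whole label sums
   factor out. *)
have lab_sum j e : lab e = Some j ->
    \sum_e' (if lab e' == Some j then (W (src e'))%:R * d e' else 0)
    = (W (src e))%:R * \sum_(e' | lab e' == Some j) d e'.
  move=> e_lab; rewrite -big_mkcond mulr_sumr; apply: eq_bigr => e' /eqP e'_lab.
  by rewrite (@lab_src e e') ?e_lab.
rewrite (lab_sum i e0) // /W connect0 mul1r -[ltRHS]addr0.
apply: ltr_leD => //; apply: sumr_le0 => j _.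
have [[e e_lab]|no_e] := pselect (exists e, lab e = Some j); last first.
  by rewrite big1 // => e _; case: eqP => // e_lab; case: no_e; exists e.
rewrite (lab_sum j e e_lab); case We: (W (src e)); last by rewrite mul0r.
by rewrite mul1r; exact: no_j e_lab We.
Qed.

(** One unit runs backwards along [e0], then along a residual path to [src e1], then along [e1]; the
    cycle closes at the sink. *)
Lemma label_exchange (i : 'I_m) : \sum_(e | lab e == Some i) d e < 0 ->
  exists j (x : edge G -> int), [/\ 0 < \sum_(e | lab e == Some j) d e,
    conformal x,
    forall v, \sum_(e | src e == v) x e = \sum_(e | tgt e == v) x e &
    forall k, \sum_(e | lab e == Some k) x e = (j == k)%:R - (i == k)%:R].
Proof.
move=> neg_i.
have [e0 /eqP e0_lab de0] : exists2 e0, lab e0 == Some i & d e0 < 0.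
  apply: contrapT => no_neg; move: neg_i; rewrite ltNge => /negP; apply.
  apply: sumr_ge0 => e e_lab; rewrite leNgt; apply/negP => ?.
  by apply: no_neg; exists e.
have [e1 [j [e1_lab pos_j de1 /connectP[r r_path r_last]]]] :=
  residual_reaches_label e0_lab neg_i.
case/shortenP: r_path r_last => {}r r_path r_uniq _ r_last.
have [x [x_conf x_supp x_bnd]] := residual_path_flow r_path r_uniq.
have x_lab e : isSome (lab e) -> x e = 0.
  by move=> e_lab; apply/eqP; apply: contraTT e_lab => /x_supp/and3P[].
exists j, (fun e =>
  x e + (if e == e1 then 1 else 0) + if e == e0 then -1 else 0).
split=> // [e|v|k].
- have [->|ne1] := eqVneq e e1.
    have [e10|_] := eqVneq e1 e0; first by move: de0; rewrite -e10; lia.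
    by rewrite x_lab ?e1_lab //; lia.
  have [->|_] := eqVneq e e0; last by rewrite !addr0; exact: x_conf.
  by rewrite x_lab ?e0_lab //; lia.
- have := x_bnd v; rewrite !big_split /= !sum_point -r_last.
  have -> : tgt e1 == v = (ord_max == v).
    by move: (labP e1); rewrite e1_lab => /esym/eqP ->.
  have -> : tgt e0 == v = (ord_max == v).
    by move: (labP e0); rewrite e0_lab => /esym/eqP ->.
  move: (\sum_(e | src e == v) x e) (\sum_(e | tgt e == v) x e) => A B.
  by do 3 case: eqP => _; move=> /= ?; lia.
rewrite !big_split /= !sum_point big1; last first.
  by move=> e /eqP e_lab; rewrite x_lab ?e_lab.
by rewrite e1_lab e0_lab !(inj_eq Some_inj); do 2 case: eqP => _; lia.
Qed.

End Exchange.

(** * Lorentzian property of labelled flow polynomials *)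

Section LabelledFlows.
Variables (R : realType) (n m : nat) (G : multigraph n) (a : 'cV[int]_n.+1).
Variable lab : edge G -> option 'I_m.
Hypothesis G_increasing : increasing G.
Hypothesis labP : forall e, isSome (lab e) = (tgt e == ord_max).
Hypothesis lab_src :
  forall e e', isSome (lab e) -> lab e = lab e' -> src e = src e'.
Implicit Types (p q : {ffun edge G -> int}) (u : 'X_{1..m}).

Let sigma := sigma_lab R a lab.

Lemma sigma_lab_supp u : sigma@_u != 0 <->
  exists2 p, lattice_points R a p & label_exponent lab p = u.
Proof.
have [B B_max] := @lattice_points_bounded R n G a G_increasing.
rewrite /sigma (mcoeff_sigma_lab _ _ B_max (leqnn B)) pnatr_eq0 -lt0n.
split=> [/card_gt0P[q]|[p Lp pu]].
  by rewrite !inE => /andP[/asboolP Lq /eqP]; exists (flowZ q).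
move: (Lp); rewrite (lattice_points_flows B_max (leqnn B)) => -[q Lq qp].
by apply/card_gt0P; exists q; rewrite inE Lq qp pu /=.
Qed.

(** Take flows [p], [q] with exponents [u], [v]; the exchange cycle [x] for [q - p] gives the flows
    [p + x] and [q - x]. *)
Lemma sigma_lab_Mconvex : Mconvex [pred u | sigma@_u != 0].
Proof.
move=> i u v /sigma_lab_supp[p Lp pu] /sigma_lab_supp[q Lq qv] lt_vu.
have [p_ge0 p_bal] := proj1 (lattice_pointsP R a p) Lp.
have [q_ge0 q_bal] := proj1 (lattice_pointsP R a q) Lq.
pose d e := q e - p e.
have d_circ w : \sum_(e | src e == w) d e = \sum_(e | tgt e == w) d e.
  by rewrite /d !sumrB q_bal p_bal opprD addrACA subrr add0r.
have dE k : \sum_(e | lab e == Some k) d e = (v k)%:Z - (u k)%:Z.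
  by rewrite -qv -pu !(label_exponentP _ _ Lp) !(label_exponentP _ _ Lq) -sumrB.
have neg_i : \sum_(e | lab e == Some i) d e < 0 by rewrite dE; lia.
have [j [x [pos_j x_conf x_circ x_lab]]] := label_exchange G_increasing labP
  lab_src d_circ neg_i.
have lt_uv : (u j < v j)%N by move: pos_j; rewrite dE; lia.
exists j; split=> //.
  apply/sigma_lab_supp; exists [ffun e => p e + x e].
    apply/lattice_pointsP; split=> [e|w].
      by rewrite ffunE; have := x_conf e; have := p_ge0 e; have := q_ge0 e;
        rewrite /d; lia.
    rewrite /balanced; under eq_bigr do rewrite ffunE.
    under [in RHS]eq_bigr do rewrite ffunE.
    by rewrite !big_split /= p_bal x_circ addrA.
  apply/mnmP => k; rewrite !(mnmE, mnmDE, mnmBE, mnm1E).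
  under eq_bigr do rewrite ffunE.
  rewrite big_split /= x_lab -(label_exponentP _ _ Lp) pu.
  by have [<-|_] := eqVneq i k; have [e|_] := eqVneq j _;
    rewrite ?e in lt_uv *; lia.
apply/sigma_lab_supp; exists [ffun e => q e - x e].
  apply/lattice_pointsP; split=> [e|w].
    by rewrite ffunE; have := x_conf e; have := p_ge0 e; have := q_ge0 e;
      rewrite /d; lia.
  rewrite /balanced; under eq_bigr do rewrite ffunE.
  under [in RHS]eq_bigr do rewrite ffunE.
  by rewrite !sumrB /= q_bal x_circ addrA.
apply/mnmP => k; rewrite !(mnmE, mnmDE, mnmBE, mnm1E).
under eq_bigr do rewrite ffunE.
rewrite sumrB /= x_lab -(label_exponentP _ _ Lq) qv.
by have [<-|_] := eqVneq j k; have [e|_] := eqVneq i _; rewrite ?e in lt_vu *;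
  lia.
Qed.

Lemma sigma_lab_lorentzian : (forall v : 'I_n.+1, v != ord_max -> 0 <= a v 0) ->
  lorentzian (normalize sigma).
Proof.
move=> a_ge0; exists `|(a ord_max 0)%R|%N.
apply: (@lorentzian_deg_coeffs _ _ _ (fun u => sigma@_u)).
- by move=> u; rewrite mcoeff_normalize.
- have [B B_max] := @lattice_points_bounded R n G a G_increasing.
  by move=> u; rewrite /sigma (mcoeff_sigma_lab _ _ B_max (leqnn B)).
- move=> u /sigma_lab_supp[p Lp <-]; exact: mdeg_label_exponent Lp.
- exact: sigma_lab_Mconvex.
(* If the supplies do not add up to zero there are no flows, and the matrix is zero. *)
move=> u; have [a_sum|a_sum] := eqVneq (\sum_v a v 0) 0.
  exact: sigma_lab_reverse_CS.
move=> x y; rewrite (_ : hess _ _ = 0) ?/form ?mulmx0 ?mul0mx ?mxE ?ltxx //.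
apply/matrixP => b c; rewrite !mxE; apply/eqP/negPn/negP.
move/sigma_lab_supp => [p /lattice_pointsP[_ p_bal] _]; case/eqP: a_sum.
have sum_fiber (f : edge G -> 'I_n.+1) : \sum_v \sum_(e | f e == v) p e
  = \sum_e p e.
  by rewrite [RHS](partition_big f xpredT).
apply: (addIr (\sum_e p e)); rewrite add0r -{1}(sum_fiber
  (@tgt _ G)) -big_split /=.
by rewrite -(sum_fiber (@src _ G)); apply: eq_bigr => v _; rewrite p_bal.
Qed.

End LabelledFlows.

Theorem theorem5p1 (R : realType) (n : nat) (G : multigraph n)
    (a : 'cV[int]_n.+1)
    (n_ge1 : (1 <= n)%N)
    (G_loopless : loopless G)
    (G_increasing : increasing G)
    (G_unique_sink : exists! v, is_sink G v)
    (a_ge0 : forall v : 'I_n.+1, v != ord_max -> 0 <= a v 0)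
    (a_le0 : a ord_max 0 <= 0) :
  lorentzian (normalize (sigma_phi G R a)) /\
  lorentzian (normalize (sigma_psi G R a)).
Proof.
split.
  pose lab (e : edge G) := [pick k : 'I_#|sink_edges G| | enum_val k == e].
  have labE e k : (lab e == Some k) = (e == enum_val k).
    rewrite /lab; case: pickP => [k' /eqP <-|no_k].
      by rewrite (inj_eq Some_inj) (inj_eq enum_val_inj).
    by rewrite [RHS]eq_sym no_k.
  rewrite (_ : sigma_phi G R a = sigma_lab R a lab); last first.
    rewrite /sigma_phi /sigma_lab; apply: eq_fsbigr => p _; congr 'X_[_].
    apply/mnmP => k; rewrite !mnmE ffunE; congr `|_|%N.
    by under eq_bigl do rewrite labE; rewrite big_pred1_eq.
  apply: sigma_lab_lorentzian => // [e|e e'].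
    rewrite /lab; case: pickP => [k /eqP <-|no_k].
      by have := enum_valP k; rewrite inE src_neq_max //= => ->.
    apply/esym/negbTE/negP => te; have es : e \in sink_edges G by
      rewrite inE te orbT.
    by have := no_k (enum_rank_in es e); rewrite enum_rankK_in // eqxx.
  case e_lab: (lab e) => [k|] // _ /esym/eqP.
  by move/eqP: e_lab; rewrite !labE => /eqP -> /eqP ->.
pose lab (e : edge G) := if tgt e == ord_max then
  [pick k : 'I_#|sink_nbrs G| | enum_val k == src e] else None.
have labE e k : (lab e == Some k) = (src e == enum_val k) && (tgt e == ord_max).
  rewrite /lab; case: (tgt e == _); last by rewrite andbF.
  rewrite andbT; case: pickP => [k' /eqP <-|no_k].
    by rewrite (inj_eq Some_inj) (inj_eq enum_val_inj).
  by rewrite [RHS]eq_sym no_k.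
rewrite (_ : sigma_psi G R a = sigma_lab R a lab); last first.
  rewrite /sigma_psi /sigma_lab; apply: eq_fsbigr => p _; congr 'X_[_].
  apply/mnmP => k; rewrite !mnmE ffunE; congr `|_|%N.
  apply: eq_bigl => e; rewrite labE !inE.
  by case: (tgt e == ord_max); rewrite ?orbT ?andbF ?andbT.
apply: sigma_lab_lorentzian => // [e|e e'].
  (* The source of an edge into the sink lies in [sink_nbrs], so [pick] cannot fail. *)
  rewrite /lab; case: eqP => // te; case: pickP => [//|no_k].
  have es : src e \in sink_nbrs G.
    rewrite inE src_neq_max //=; apply/card_gt0P; exists e.
    by rewrite inE eqxx te /=.
  by have := no_k (enum_rank_in es (src e)); rewrite enum_rankK_in // eqxx.
case e_lab: (lab e) => [k|] // _ /esym/eqP.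
by move/eqP: e_lab; rewrite !labE => /andP[/eqP -> _] /andP[/eqP ->].
Qed.
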